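(* For every integer $a\ge 4$, the complete graph $K_a$ is not $\binom{a}{2}$-anti-common.
   Context: All graphs are finite and simple. An $r$-edge-coloring of a graph is a function from its edge set to $\{1,\dots,r\}$ (not necessarily proper). A subgraph is rainbow if its edges have pairwise distinct colors. A copy of $H$ in $K_n$ is a (not necessarily induced) subgraph of $K_n$ isomorphic to $H$. Let $H$ be a graph with $m$ vertices and $e$ edges. $rb_r(H;n)$ denotes the maximum, over all $r$-edge-colorings of $K_n$, of the number of rainbow copies of $H$ in $K_n$. For $n\ge m$ put $rbC_r(H;n)=\dfrac{rb_r(H;n)}{\binom{n}{m}\frac{m!}{|\mathrm{Aut}(H)|}}$, and let $rbC_r(H)=\lim_{n\to\infty} rbC_r(H;n)$ (this limit exists). For an integer $r\ge m$, $H$ is called $r$-anti-common if $rbC_r(H)=\dfrac{\binom{r}{e}e!}{r^e}$. *)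

(* Defs.v *)
From HB Require Import structures.
From mathcomp Require Import all_boot all_order all_fingroup all_algebra.
From mathcomp Require Import all_classical all_reals all_analysis.

Set Implicit Arguments.
Unset Strict Implicit.
Unset Printing Implicit Defensive.

Import Order.TTheory GRing.Theory Num.Theory.
Import numFieldNormedType.Exports.

Local Open Scope ring_scope.

Record sgraph := SGraph {
  svertex :> finType;
  sedge : rel svertex;
  sedge_sym : symmetric sedge;
  sedge_irr : irreflexive sedge }.

Definition edges (G : sgraph) : {set {set G}} :=
  [set [set x; y] | x in [set: G], y in [set: G] & sedge x y]%SET.

Lemma neq_sym (T : eqType) : symmetric [rel x y : T | x != y].
Proof. by move=> x y /=; rewrite eq_sym. Qed.

Lemma neq_irr (T : eqType) : irreflexive [rel x y : T | x != y].
Proof. by move=> x /=; rewrite eqxx. Qed.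

Definition complete (n : nat) : sgraph :=
  @SGraph 'I_n [rel x y | x != y] (@neq_sym 'I_n) (@neq_irr 'I_n).

Definition Aut_graph (H : sgraph) : {set {perm H}} :=
  [set s : {perm H} | [forall x, forall y, sedge (s x) (s y) == sedge x y]]%SET.

(* A subgraph is given by its vertex set and its edge set. *)
Definition is_subgraph (G : sgraph) (S : {set G} * {set {set G}}) : bool :=
  (S.2 \subset edges G) && [forall e in S.2, e \subset S.1].

Definition is_copy (H G : sgraph) (S : {set G} * {set {set G}}) : bool :=
  is_subgraph S &&
  [exists f : {ffun H -> G},
    [&& injectiveb f, [set f x | x in [set: H]]%SET == S.1 &
        [forall x, forall y, sedge x y == ([set f x; f y]%SET \in S.2)]]].

Definition edge_coloring (r : nat) (G : sgraph) : finType :=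
  {ffun {e : {set G} | e \in edges G} -> 'I_r}.

Definition rainbow (r : nat) (G : sgraph) (c : edge_coloring r G)
    (S : {set G} * {set {set G}}) : bool :=
  dinjectiveb c [pred e | val e \in S.2].

Definition rainbow_copies (r : nat) (H G : sgraph) (c : edge_coloring r G) :
    {set {set G} * {set {set G}}} :=
  [set S | is_copy H S && rainbow c S]%SET.

Definition rb (r : nat) (H : sgraph) (n : nat) : nat :=
  (\max_(c : edge_coloring r (complete n)) #|rainbow_copies H c|)%N.

(* Meaningful for n >= #|H|; for smaller n the denominator, hence the
   quotient, is 0. *)
Definition rbC_seq (R : realType) (r : nat) (H : sgraph) (n : nat) : R :=
  (rb r H n)%:R / (('C(n, #|H|) * (#|H|)`!)%N%:R / #|Aut_graph H|%:R).

Definition rbC (R : realType) (r : nat) (H : sgraph) : R :=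
  limn (rbC_seq R r H).

(* Intended for r >= #|H|. *)
Definition anti_common (R : realType) (r : nat) (H : sgraph) : Prop :=
  rbC R r H = ('C(r, #|edges H|) * (#|edges H|)`!)%N%:R / r%:R ^+ #|edges H|.

(* Main.v *)
Require Import Defs.
From mathcomp Require Import all_boot all_order all_fingroup all_algebra.
From mathcomp Require Import all_classical all_reals all_analysis.
Import Order.TTheory GRing.Theory Num.Theory numFieldNormedType.Exports.

(** Write [e] for ['C(a, 2)], the number of edges of [K_a].  With [e] colors
    the anti-common value ['C(e, e) * e! / e ^ e] is [e! / e ^ e], the
    probability that a uniformly random coloring makes a given [K_a] rainbow.
    A structured coloring does better.  Split [k * a] vertices into [a] parts
    of size [k], fix a bijection between the pairs of parts and the [e] colors,
    and color an edge by the pair of parts that it joins (edges inside a part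
    are colored arbitrarily).  Each of the [k ^ a] transversals of the parts
    spans a rainbow [K_a] ([rb_blowup]), so the density of rainbow copies is at
    least [k ^ a / 'C(k * a, a) >= a! / a ^ a] for every [k > 0]
    ([rbC_seq_blowup]).

    The sequence [n! / n ^ n] is strictly decreasing ([fact_ratio_decr]), and
    [a < e] as soon as [4 <= a] (for [a = 3] the two values coincide).  Hence
    [e! / e ^ e < a! / a ^ a], while the densities are at least [a! / a ^ a]
    for infinitely many [n], which keeps the limit away from [e! / e ^ e]. *)

Local Open Scope nat_scope.

Lemma ffact_le_expn n m : n ^_ m <= n ^ m.
Proof.
have -> : n ^ m = \prod_(i < m) n by rewrite prod_nat_const card_ord.
by rewrite ffact_prod; apply: leq_prod => i _; exact: leq_subr.
Qed.

(** Passing from [m!] to [n!] multiplies by [n - m] factors that are at most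
    [n], while passing from [m ^ m] to [n ^ n] multiplies by [n ^ (n - m)] and
    also enlarges the base of the first [m] factors. *)
Lemma fact_ratio_decr m n : 0 < m -> m < n -> n`! * m ^ m < m`! * n ^ n.
Proof.
move=> m_gt0 lt_mn; have le_mn := ltnW lt_mn.
rewrite -(ffact_fact (leq_subr m n)) subKn // mulnAC mulnC.
rewrite ltn_pmul2l ?fact_gt0 //.
rewrite -{4}(subnK le_mn) expnD.
apply: (@leq_ltn_trans (n ^ (n - m) * m ^ m)).
  by rewrite leq_mul2r ffact_le_expn orbT.
by rewrite ltn_pmul2l ?expn_gt0 ?(leq_ltn_trans _ lt_mn) // ltn_exp2r.
Qed.

Lemma edges_complete n :
  edges (complete n) = [set A : {set complete n} | #|A| == 2].
Proof.
apply/setP => A; rewrite inE; apply/imset2P/cards2P.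
  by case=> x y _; rewrite !inE /= => neq_xy ->; exists x, y.
by case=> x [y [neq_xy ->]]; exists x y; rewrite ?inE.
Qed.

Lemma card_edges_complete n : #|edges (complete n)| = 'C(n, 2).
Proof. by rewrite edges_complete card_draws card_ord. Qed.

Lemma card_Aut_complete n : #|Aut_graph (complete n)| = n`!.
Proof.
rewrite -card_Sn -cardsT; congr #|pred_of_set _|; apply/setP => s.
rewrite !inE; apply/forallP => x; apply/forallP => y /=.
by rewrite (inj_eq perm_inj).
Qed.

Definition induced_subgraph {G : sgraph} (V : {set G}) :
    {set G} * {set {set G}} :=
  (V, [set e in edges G | e \subset V]).

Lemma clique_is_copy n a (V : {set complete n}) :
  #|V| = a -> is_copy (complete a) (induced_subgraph V).
Proof.
move=> <-{a}; rewrite /is_copy /is_subgraph /=; apply/andP; split.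
  apply/andP; split; first by apply/fintype.subsetP => e; rewrite inE => /andP[].
  by apply/forallP => e; apply/implyP; rewrite inE => /andP[].
apply/existsP; exists [ffun i : 'I_#|V| => enum_val i]; apply/and3P; split.
- by apply/injectiveP => i j; rewrite !ffunE => /enum_val_inj.
- apply/eqP/setP => x; apply/imsetP/idP => [[i _ ->]|Vx].
    by rewrite ffunE enum_valP.
  by exists (enum_rank_in Vx x); rewrite ?inE // ffunE enum_rankK_in.
- apply/forallP => i; apply/forallP => j; rewrite !ffunE inE /=.
  rewrite edges_complete inE cards2 (inj_eq enum_val_inj).
  have -> : [set enum_val i; enum_val j] \subset V.
    by rewrite finset.subUset !finset.sub1set !enum_valP.
  by rewrite andbT; case: (i == j).
Qed.

(** The coloring of the blow-up of [K_a] along the vertex partition [p], where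
    [g] colors the edges of [K_a]. *)
Definition blowup_coloring {n a r} (p : 'I_n -> 'I_a) (g : {set 'I_a} -> 'I_r) :
    edge_coloring r (complete n) :=
  [ffun e => g (p @: (val e : {set 'I_n}))].

(** An edge inside a transversal [V] is determined by the pair of parts that
    it joins, hence by its color. *)
Lemma rainbow_transversal n a r (p : 'I_n -> 'I_a) (g : {set 'I_a} -> 'I_r)
    (V : {set complete n}) :
  {in edges (complete a) &, injective g} -> {in V &, injective p} ->
  rainbow (blowup_coloring p g) (induced_subgraph V).
Proof.
move=> g_inj p_inj; apply/dinjectiveP => e1 e2.
rewrite !inE => /andP[E1 s1] /andP[E2 s2]; rewrite !ffunE.
have pE (e : {set complete n}) : e \in edges (complete n) -> e \subset V ->
    p @: e \in edges (complete a).
  rewrite !edges_complete !inE => ce se; rewrite card_in_imset //.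
  by move=> x y xe ye; apply: p_inj; apply: (fintype.subsetP se).
move=> /(g_inj _ _ (pE _ E1 s1) (pE _ E2 s2)) eq_p; apply: val_inj.
have sub (d1 d2 : {set complete n}) : d1 \subset V -> d2 \subset V ->
    p @: d1 = p @: d2 -> d1 \subset d2.
  move=> sd1 sd2 eqd; apply/fintype.subsetP => x xd1.
  have : p x \in p @: d2 by rewrite -eqd imset_f.
  case/imsetP => y yd2 eq_pxy; suff -> : x = y by [].
  apply: p_inj eq_pxy; first exact: (fintype.subsetP sd1).
  exact: (fintype.subsetP sd2).
by apply/eqP; rewrite finset.eqEsubset; apply/andP; split; exact: sub.
Qed.

Lemma ex_inj_in (T : finType) (A : {set T}) :
  0 < #|A| -> exists g : T -> 'I_#|A|, {in A &, injective g}.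
Proof.
case/card_gt0P => x0 Ax0; exists (enum_rank_in Ax0) => x y Ax Ay.
exact: enum_rank_in_inj.
Qed.

Lemma rb_blowup a k : 1 < a -> k ^ a <= rb 'C(a, 2) (complete a) (k * a).
Proof.
move=> a_gt1; rewrite -(card_edges_complete a).
have [|g g_inj] := @ex_inj_in _ (edges (complete a)).
  by rewrite card_edges_complete bin_gt0.
(* [u (j, i)] is the [j]-th vertex of the [i]-th part *)
have [v uK _] := curry_mxvec_bij k a.
set u := uncurry _ in uK.
have u_inj (q q' : 'I_k * 'I_a) : u q = u q' -> q = q'.
  by move=> equ; rewrite -(uK q) ?inE // -(uK q') ?inE // equ.
pose p x := (v x).2.
have pu j i : p (u (j, i)) = i by rewrite /p uK ?inE.
pose V (f : {ffun 'I_a -> 'I_k}) : {set complete (k * a)} :=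
  [set u (f i, i) | i in [set: 'I_a]].
have V_inj : injective V.
  move=> f f' eqV; apply/ffunP => i.
  have : u (f i, i) \in V f' by rewrite -eqV; apply/imsetP; exists i.
  by case/imsetP => j _ /u_inj [-> <-].
have pV f : {in V f &, injective p}.
  by move=> _ _ /imsetP[i _ ->] /imsetP[j _ ->]; rewrite !pu => ->.
have cardV f : #|V f| = a.
  by rewrite card_imset ?cardsT ?card_ord // => i j /u_inj[].
apply: leq_trans (leq_bigmax (blowup_coloring p g)).
have -> : k ^ a =
    #|[set induced_subgraph (V f) | f in [set: {ffun 'I_a -> 'I_k}]]|.
  rewrite card_imset ?cardsT ?card_ffun ?card_ord //.
  by move=> f f' [/V_inj].
apply/subset_leq_card/fintype.subsetP => _ /imsetP[f _ ->].
by rewrite inE clique_is_copy ?rainbow_transversal.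
Qed.

Local Open Scope ring_scope.

Lemma rbC_seq_blowup (R : realType) a k : (1 < a)%N -> (0 < k)%N ->
  (a`!)%:R / (a ^ a)%:R <= rbC_seq R 'C(a, 2) (complete a) (k * a).
Proof.
move=> a_gt1 k_gt0; have a_gt0 := ltnW a_gt1.
rewrite /rbC_seq card_Aut_complete card_ord bin_ffact.
have le_a : (a <= k * a)%N by rewrite leq_pmull.
rewrite invf_div mulrA ler_pdivrMr ?ltr0n ?expn_gt0 ?a_gt0 //.
rewrite mulrAC ler_pdivlMr ?ltr0n ?ffact_gt0 // -!natrM ler_nat.
rewrite mulnC mulnAC leq_mul2r; apply/orP; right.
apply: leq_trans (ffact_le_expn _ _) _.
by rewrite expnMn leq_mul2r rb_blowup ?orbT.
Qed.

Theorem theorem4p3 (R : realType) (a : nat) (ha : (4 <= a)%N) :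
  ~ anti_common R 'C(a, 2) (complete a).
Proof.
rewrite /anti_common card_edges_complete binn mul1n => rbCE.
have a_gt1 : (1 < a)%N by apply: leq_trans ha.
have a_gt0 := ltnW a_gt1.
have lt_ae : (a < 'C(a, 2))%N.
  case: a ha a_gt0 {rbCE a_gt1} => // b ha _.
  by rewrite -(ltn_pmul2l (isT : 0 < 2)%N) -mul_bin_diag bin1 mulnC ltn_pmul2l.
set e := 'C(a, 2) in rbCE lt_ae *.
have e_gt0 : (0 < e)%N by apply: ltn_trans lt_ae.
have lt_rbC : rbC R e (complete a) < (a`!)%:R / (a ^ a)%:R.
  rewrite rbCE -natrX ltr_pdivrMr ?ltr0n ?expn_gt0 ?e_gt0 //.
  rewrite mulrAC ltr_pdivlMr ?ltr0n ?expn_gt0 ?a_gt0 // -!natrM ltr_nat.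
  exact: fact_ratio_decr.
(* A divergent sequence has default limit [0], which is not [e! / e ^ e]. *)
have cvg_rbC : cvgn (rbC_seq R e (complete a)).
  apply: contrapT => /dvgP lim0.
  have : 0 < rbC R e (complete a).
    by rewrite rbCE divr_gt0 ?exprn_gt0 ?ltr0n ?fact_gt0.
  by rewrite /rbC lim0 ltxx.
have [N _ ltN] := cvgr_lt _ cvg_rbC _ lt_rbC.
have := ltN (N.+1 * a)%N (leq_trans (leqnSn N) (leq_pmulr _ a_gt0)).
by rewrite ltNge rbC_seq_blowup.
Qed.
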